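(* There are sets $\mathcal{B}\subseteq\mathbb{N}\setminus\{1\}$ such that, writing $\eta=1_{\mathcal{F}_{\mathcal{B}}}\in\{0,1\}^{\mathbb{Z}}$: (i) $\eta$ is an irregular Toeplitz sequence; (ii) $(X_\eta,S)$ is uniquely ergodic, in particular of entropy zero.
   Context: $\mathbb{N}=\{1,2,3,\dots\}$. For $\mathcal{B}\subseteq\mathbb{N}$ let $\mathcal{M}_{\mathcal{B}}=\bigcup_{b\in\mathcal{B}}b\mathbb{Z}$ and $\mathcal{F}_{\mathcal{B}}=\mathbb{Z}\setminus\mathcal{M}_{\mathcal{B}}$; $\eta=1_{\mathcal{F}_{\mathcal{B}}}\in\{0,1\}^{\mathbb{Z}}$ is the indicator sequence of $\mathcal{F}_{\mathcal{B}}$. $S$ is the left shift on $\{0,1\}^{\mathbb{Z}}$ and $X_\eta$ is the closure of $\{S^n\eta:n\in\mathbb{Z}\}$; uniquely ergodic means that there is exactly one $S$-invariant Borel probability measure on $X_\eta$. A sequence $\omega\in\{0,1\}^{\mathbb{Z}}$ is a Toeplitz sequence if for each $n\in\mathbb{Z}$ there is a positive integer $p$ with $\omega_n=\omega_{n+kp}$ for all $k\in\mathbb{Z}$. For $p\in\mathbb{N}$ let $\mathsf{Per}_p(\omega)=\{n\in\mathbb{Z}:\omega_n=\omega_{n+kp}\text{ for all }k\in\mathbb{Z}\}$. A Toeplitz sequence $\omega$ is regular if $\sup_{p\in\mathbb{N}}d(\mathsf{Per}_p(\omega))=1$, and irregular otherwise, where $d(M)=\lim_{N\to\infty}N^{-1}\operatorname{card}(M\cap[1,N])$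 denotes asymptotic density. *)

(* Defs.v *)
From HB Require Import structures.
From mathcomp Require Import all_boot all_order all_algebra.
From mathcomp Require Import all_classical all_reals all_analysis.

Set Implicit Arguments.
Unset Strict Implicit.
Unset Printing Implicit Defensive.

Import Order.TTheory GRing.Theory Num.Theory.
Import numFieldNormedType.Exports.

Local Open Scope classical_set_scope.
Local Open Scope ring_scope.

Definition multiples (B : set nat) : set int :=
  \bigcup_(b in B) [set b%:Z * k | k in [set: int]].

Definition Bfree (B : set nat) : set int := ~` multiples B.

(* The full two-sided shift {0,1}^Z, with the product of the discrete
   topologies; [true] stands for 1 and [false] for 0. *)
Definition biseq : Type := prod_topology (fun _ : int => bool).

HB.instance Definition _ := Pointed.on biseq.
HB.instance Definition _ := Nbhs.on biseq.
HB.instance Definition _ := Topological.on biseq.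

Definition Bfree_seq (B : set nat) : biseq := fun n => `[< Bfree B n >].

Definition shift_pow (n : int) (w : biseq) : biseq := fun k => w (k + n).

Definition left_shift : biseq -> biseq := shift_pow 1.

Definition orbit_closure (w : biseq) : set biseq :=
  closure [set shift_pow n w | n in [set: int]].

Definition Per (p : nat) (w : biseq) : set int :=
  [set n | forall k : int, w n = w (n + k * p%:Z)].

Definition Toeplitz (w : biseq) : Prop :=
  forall n : int, exists2 p : nat, (0 < p)%N & Per p w n.

(* Asymptotic density; [limn] is only meaningful when the limit exists, which
   is the case for the periodic sets [Per p w] (p > 0) used below. *)
Definition asymptotic_density (R : realType) (M : set int) : R :=
  limn (fun N : nat =>
    N%:R^-1 * #|[set i : 'I_N | `[< M (i.+1)%:Z >]]%SET|%:R : R).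

Definition regular_Toeplitz (R : realType) (w : biseq) : Prop :=
  Toeplitz w /\
  sup [set asymptotic_density R (Per p w) | p in [set p : nat | (0 < p)%N]] = 1.

Definition irregular_Toeplitz (R : realType) (w : biseq) : Prop :=
  Toeplitz w /\ ~ regular_Toeplitz R w.

Definition borel_type (T : ptopologicalType) := g_sigma_algebraType (@open T).

(* A Borel probability measure on a closed subset X of T is represented by the
   Borel probability measure on T giving mass 1 to X. *)
Definition invariant_probability (R : realType) (T : ptopologicalType)
    (X : set T) (f : T -> T) (P : probability (borel_type T) R) : Prop :=
  P X = 1%E /\
  forall A : set (borel_type T), measurable A -> P (f @^-1` A) = P A.

(* Values of a [probability] on non-measurable sets are unconstrained, hence
   uniqueness is agreement on Borel sets. *)
Definition uniquely_ergodic (R : realType) (T : ptopologicalType)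
    (X : set T) (f : T -> T) : Prop :=
  exists P : probability (borel_type T) R,
    invariant_probability X f P /\
    forall Q : probability (borel_type T) R, invariant_probability X f Q ->
      forall A : set (borel_type T), measurable A -> Q A = P A.

(* Topological entropy of f on a compact f-invariant subset X of T, following
   Adler, Konheim and McAndrew.  Open covers of X are given by open sets of the
   ambient space. *)
Definition open_cover (T : topologicalType) (X : set T) (U : set (set T)) :
    Prop :=
  (forall A, U A -> open A) /\ X `<=` \bigcup_(A in U) A.

(* Least cardinality of a subfamily of U covering X, +oo if none is finite. *)
Definition cover_number (R : realType) (T : Type) (X : set T)
    (U : set (set T)) : \bar R :=
  ereal_inf [set (n%:R : R)%:E | n in
    [set n : nat | exists A : 'I_n -> set T,
       (forall i, U (A i)) /\ X `<=` \bigcup_i A i]].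

(* The join of U, f^-1 U, ..., f^-(n-1) U. *)
Definition cover_join (T : Type) (f : T -> T) (U : set (set T)) (n : nat) :
    set (set T) :=
  [set \bigcap_(i in `I_n) (iter i f @^-1` A i) | A in
    [set A : nat -> set T | forall i, U (A i)]].

Definition cover_entropy (R : realType) (T : Type) (X : set T) (f : T -> T)
    (U : set (set T)) : \bar R :=
  limn_esup (fun n : nat =>
    (n%:R^-1)%:E * lne (cover_number R X (cover_join f U n)))%E.

Definition topological_entropy (R : realType) (T : topologicalType)
    (X : set T) (f : T -> T) : \bar R :=
  ereal_sup [set cover_entropy R X f U | U in [set U | open_cover X U]].

(* Main.v *)
(* W_0, W_1, ... are moduli all of whose divisors d > 1 exceed P_k + k, where
   P_k = W_0 ... W_(k-1), and with phi(W_k)/W_k <= 2^-(k+3).  An integer is "hit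
   at level k" if W_k divides it and it is coprime to none of W_0, ..., W_(k-1);
   B consists of the b > 1 that are hit at some level.

   - Toeplitz: every n <> 0 is coprime to W_|n|, hence only finitely many levels
     matter for n, and each level is periodic.
   - Irregular: a class n + pZ avoiding all hits must be coprime to some W_i, as
     otherwise, W_p being coprime to p P_p, the Chinese remainder theorem yields
     a hit at level p.  So Per_p has density at most
     sum 1/W_k + sum phi(W_i)/W_i <= 1/2.
   - If W_k divides n, then n + j is coprime to W_k for 0 < |j| <= P_k, so hits
     at levels >= K are more than P_K apart.  Hence in each window of length P_K
     the sequence eta differs in at most one place from a fixed P_K-periodic
     sequence.  This gives uniform frequencies of words (unique ergodicity) and
     at most P_K (P_K + 1)^(l/P_K + 1) words of length l (entropy zero). *)
From HB Require Import structures.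
Require Import Defs.
From mathcomp Require Import all_boot all_order all_algebra.
From mathcomp Require Import all_classical all_reals all_analysis.
From mathcomp Require Import measurable_realfun cyclic zify ring lra.

Set Implicit Arguments.
Unset Strict Implicit.
Unset Printing Implicit Defensive.

Import Order.TTheory GRing.Theory Num.Theory.
Import numFieldNormedType.Exports.

Local Open Scope classical_set_scope.
Local Open Scope ring_scope.

(** * Moduli with small totient quotient *)

(** Being coprime to [a * b] implies being coprime to [b], and the integers below [a * b] split into
    [a] complete residue systems mod [b]. *)
Lemma totientM_le (a b : nat) : (totient (a * b) <= a * totient b)%N.
Proof.
case: b => [|b]; first by rewrite muln0 leq0n.
rewrite !totient_count_coprime.
apply: (@leq_trans (\sum_(0 <= d < a * b.+1) coprime b.+1 d)).
  by apply: leq_sum => d _; rewrite coprimeMl;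
    case: (coprime b.+1 d); rewrite ?andbT ?andbF ?leq_b1.
elim: a => [|a IHa]; first by rewrite mul0n big_geq.
rewrite [(a.+1 * b.+1)%N]mulSnr (@big_cat_nat _ _ _ (a * b.+1)) ?leq_addr //=.
rewrite [leqRHS]mulSnr leq_add //.
rewrite -{1}[(a * b.+1)%N]add0n big_addn addnC addnK.
by apply: leq_sum => d _; rewrite addnC /coprime gcdnMDl.
Qed.

(** Divergence of the harmonic series, used without primes: [W] is a product of numbers [j A + 1]
    with [A = N!], which have no divisors in [[2, N]]. The divisors [W / (j A + 1)] of [W] are
    distinct, so by Gauss' identity their totients sum to at most [W], while each of them is at
    least [totient W / (j A + 1)]. *)
Lemma exists_small_totient (N m : nat) : exists W : nat,
  [/\ (0 < W)%N, (forall d, (d %| W)%N -> (d <= N)%N -> d = 1%N) &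
      (2 ^ m * totient W <= W)%N].
Proof.
(* Each of the [a] dyadic blocks of [j] contributes at least [totient W / (2 A)] to the sum, so
   [a = 2 A 2^m] blocks yield the factor [2^m]. *)
pose A := N`!; pose a := (2 * A * 2 ^ m)%N.
pose W := (\prod_(j < 2 ^ a) (j * A).+1)%N.
have A0 : (0 < A)%N by rewrite fact_gt0.
have W0 : (0 < W)%N by apply: prodn_gt0.
have dW j : (j < 2 ^ a)%N -> ((j * A).+1 %| W)%N.
  by move=> ja; rewrite /W (bigD1 (Ordinal ja)) //= dvdn_mulr.
exists W; split=> //.
  move=> d dvW dN.
  have d0 : (0 < d)%N by apply: dvdn_gt0 dvW.
  have cop : coprime d W.
    rewrite /W; elim/big_rec: _ => [|j x _ IH]; first exact: coprimen1.
    rewrite coprimeMr IH andbT.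
    have /dvdnP[q ->] : (d %| j * A)%N by rewrite dvdn_mull // dvdn_fact // d0.
    by rewrite -addn1 /coprime gcdnMDl gcdn1.
  by apply/eqP; move: cop; rewrite /coprime (gcdn_idPl dvW).
have tot : (\sum_(j < 2 ^ a) totient (W %/ (j * A).+1) <= W)%N.
  pose h (j : 'I_(2 ^ a)) : 'I_W.+1 := inord (W %/ (j * A).+1).
  have hE j : h j = (W %/ (j * A).+1)%N :> nat by rewrite inordK // ltnS leq_div.
  have hinj : injective h.
    move=> j j' /(congr1 val); rewrite /= !hE => e; apply: val_inj => /=.
    have e' : (W %/ (j * A).+1 * (j * A).+1 = W %/ (j * A).+1 * (j' * A).+1)%N.
      by rewrite {2}e !divnK // dW.
    have q0 : (0 < W %/ (j * A).+1)%N by rewrite divn_gt0 // dvdn_leq // dW.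
    move/eqP: e'; rewrite eqn_pmul2l // eqSS eqn_pmul2r //; exact/eqP.
  rewrite (eq_bigr (fun j => totient (h j))); last by move=> j _; rewrite hE.
  rewrite -[leqRHS]sum_totient_dvd.
  rewrite -(big_map h predT (fun i : 'I_W.+1 => totient i)).
  rewrite big_uniq ?map_inj_uniq ?index_enum_uniq //=.
  rewrite [leqLHS]big_mkcond [leqRHS]big_mkcond leq_sum // => i _.
  case: ifPn => // /mapP[j _ ->]; case: ifPn => // /negP; case.
  by rewrite hE dvdn_div // dW.
(* The block [2^b <= j < 2^(b+1)] has [2^b] terms, and there [j A + 1 <= 2^b (2 A)]. *)
have blocks b : (b <= a)%N ->
    (b * totient W <= 2 * A * \sum_(0 <= j < 2 ^ b) totient (W %/ (j * A).+1))%N.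
  elim: b => [|b IHb] ba; first by rewrite mul0n.
  rewrite (@big_cat_nat _ _ _ (2 ^ b)%N) ?leq_exp2l //= mulnDr mulSnr.
  rewrite leq_add ?(IHb (ltnW ba)) //.
  rewrite -(@leq_pmul2l (2 ^ b)%N) ?expn_gt0 //.
  rewrite mulnA (mulnA (2 ^ b)%N) -expnSr big_distrr /=.
  have -> : (2 ^ b * totient W = \sum_(2 ^ b <= j < 2 ^ b.+1) totient W)%N.
    by rewrite sum_nat_const_nat expnS mul2n -addnn addnK.
  rewrite big_nat_cond [leqRHS]big_nat_cond; apply: leq_sum => j /andP[/andP[_ jb] _].
  have dj : ((j * A).+1 %| W)%N.
    by apply: dW; apply: leq_trans jb _; rewrite leq_exp2l.
  rewrite -{1}(divnK dj) mulnC; apply: leq_trans (totientM_le _ _) _.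
  rewrite leq_mul2r; apply/orP; right.
  apply: leq_trans (_ : j.+1 * A <= _)%N; last by rewrite leq_mul2r jb orbT.
  by rewrite mulSn; lia.
have /(_ (leqnn a)) := blocks a.
rewrite big_mkord => /leq_trans /(_ (leq_mul (leqnn (2 * A)%N) tot)).
by rewrite {1}/a -mulnA leq_pmul2l ?muln_gt0 //.
Qed.

(** * Counting over periods *)

Lemma sum_periodic_shift (p : nat) (f : int -> nat) (t : int) :
  (forall x, f (x + p%:Z) = f x) ->
  (\sum_(i < p) f (t + i%:Z)%R = \sum_(i < p) f i%:Z)%N.
Proof.
move=> fp; pose g t := (\sum_(i < p) f (t + i%:Z)%R)%N.
have gS u : g (u + 1) = g u.
  rewrite /g; case: p fp @g => [|p] fp g; first by rewrite !big_ord0.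
  rewrite big_ord_recr big_ord_recl /= addnC; congr (_ + _)%N.
    by rewrite addr0 -[in RHS](fp u); congr f; rewrite -addrA -PoszD add1n.
  by apply: eq_bigr => i _; congr f; rewrite -addrA -PoszD add1n.
have gD n u : g (u + n%:Z) = g u.
  elim: n u => [|n IHn] u; first by rewrite addr0.
  by rewrite -addn1 PoszD addrA gS IHn.
have g0 : g 0 = (\sum_(i < p) f i%:Z)%N by apply: eq_bigr => i _; rewrite add0r.
rewrite -/(g t) -g0; case: (intP t) => [//|n|n]; first by rewrite -[RHS](gD n.+1) add0r.
by rewrite -(gD n.+1) addNr.
Qed.

Lemma sum_periodic_mul (p q : nat) (f : int -> nat) (t : int) :
  (forall x, f (x + p%:Z) = f x) ->
  (\sum_(i < q * p) f (t + i%:Z)%R = q * \sum_(i < p) f i%:Z)%N.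
Proof.
move=> fp; elim: q t => [|q IHq] t; first by rewrite !mul0n big_ord0.
rewrite mulSn big_split_ord /= mulSn (sum_periodic_shift _ fp) -(IHq (t + p%:Z)).
by congr (_ + _)%N; apply: eq_bigr => i _; rewrite PoszD addrA.
Qed.

Lemma sum_dvdn (d N : nat) : (0 < d)%N ->
  (\sum_(i < N) (d %| i.+1) = N %/ d)%N.
Proof.
move=> d0; elim: N => [|N IHN]; first by rewrite big_ord0 div0n.
by rewrite big_ord_recr /= IHN divnS // addnC.
Qed.

(** Rounding [N] up to a multiple of [d] leaves whole periods, each with [totient d] integers
    coprime to [d]. *)
Lemma sum_coprime_le (d N : nat) : (0 < d)%N ->
  (\sum_(i < N) coprime d i.+1 <= (N %/ d).+1 * totient d)%N.
Proof.
move=> d0; set M := ((N %/ d).+1 * d)%N.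
have NM : (N <= M)%N by rewrite ltnW // /M -ltn_divLR //.
rewrite totient_count_coprime big_mkord.
have cp (x : int) : coprimez d%:Z (x + d%:Z) = coprimez d%:Z x :> nat.
  by rewrite /coprimez gcdzDr.
rewrite -(@sum_periodic_mul d _ (fun x => coprimez d%:Z x) 1 cp) -/M.
have -> : (\sum_(i < M) coprimez d%:Z (1 + i%:Z)%R = \sum_(i < M) coprime d i.+1)%N.
  by apply: eq_bigr => i _; rewrite coprimezE -PoszD add1n.
rewrite -!(big_mkord xpredT (fun i => nat_of_bool (coprime d i.+1))).
by rewrite (@big_cat_nat _ _ _ N 0 M) //= leq_addr.
Qed.

(** * The sieving moduli and the sieved set *)

Definition period (W : nat -> nat) (k : nat) : nat := (\prod_(i < k) W i)%N.

Definition sieving_moduli (W : nat -> nat) : Prop := forall k,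
  [/\ (0 < W k)%N,
      (forall d, (d %| W k)%N -> (d <= period W k + k)%N -> d = 1%N) &
      (2 ^ (k + 3) * totient (W k) <= W k)%N].

Lemma exists_sieving_moduli : exists W : nat -> nat, sieving_moduli W.
Proof.
have /choice[f fP] := fun Nm => exists_small_totient Nm.1 Nm.2.
(* The choice of [W k] depends on the earlier moduli only through their product, so the recursion
   runs on that product. *)
pose P := fix P k := if k is k'.+1 then (P k' * f (P k' + k', k' + 3))%N else 1%N.
exists (fun k => f (P k + k, k + 3)%N) => k.
suff -> : period (fun k => f (P k + k, k + 3)%N) k = P k by exact: (fP (P k + k, k + 3)%N).
by rewrite /period; elim: k => [|k IHk]; rewrite ?big_ord0 // big_ord_recr /= IHk.
Qed.

Definition hit (W : nat -> nat) (k : nat) (n : int) : bool :=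
  ((W k)%:Z %| n)%Z && [forall i : 'I_k, ~~ coprimez (W i)%:Z n].

Definition sieve (W : nat -> nat) : set nat :=
  [set b | (1 < b)%N /\ exists k, hit W k b%:Z].

Section Sieve.
Variable W : nat -> nat.
Hypothesis HW : sieving_moduli W.

Local Notation P := (period W).
Local Notation hit := (hit W).
Local Notation sieve := (sieve W).

Let W_gt0 k : (0 < W k)%N. Proof. by case: (HW k). Qed.
Let W_rough k d : (d %| W k)%N -> (d <= P k + k)%N -> d = 1%N.
Proof. by case: (HW k) => _ + _; apply. Qed.
Let W_totient k : (2 ^ (k + 3) * totient (W k) <= W k)%N.
Proof. by case: (HW k). Qed.

Lemma modulus_large k : (2 ^ (k + 3) <= W k)%N.
Proof.
by apply: leq_trans (W_totient k); rewrite leq_pmulr // totient_gt0.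
Qed.

Lemma modulus_gt1 k : (1 < W k)%N.
Proof. by apply: leq_trans (modulus_large k); rewrite -{1}(expn0 2) ltn_exp2l // addn3. Qed.

Lemma modulus_gt k : (P k + k < W k)%N.
Proof.
rewrite ltnNge; apply/negP => /(W_rough (dvdnn _)) W1.
by have := modulus_gt1 k; rewrite W1.
Qed.

Lemma period_gt0 k : (0 < P k)%N.
Proof. exact: prodn_gt0. Qed.

Lemma period_dvd k l : (k <= l)%N -> (P k %| P l)%N.
Proof.
move/subnK <-; elim: (l - k)%N => // m IH.
by rewrite addSn /period big_ord_recr /= dvdn_mulr.
Qed.

Lemma modulus_dvd_period i k : (i < k)%N -> (W i %| P k)%N.
Proof. by move=> ik; rewrite /period (bigD1 (Ordinal ik)) //= dvdn_mulr. Qed.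

Lemma roughness_mono k l : (k <= l)%N -> (P k + k <= P l + l)%N.
Proof. by move=> kl; rewrite leq_add // dvdn_leq ?period_gt0 ?period_dvd. Qed.

Lemma gcd_period i k n m : (i < k)%N ->
  gcdz (W i)%:Z (n + m * (P k)%:Z) = gcdz (W i)%:Z n.
Proof.
by move=> /modulus_dvd_period/dvdnP[q ->]; rewrite PoszM mulrA addrC gcdzMDl.
Qed.

Lemma hit_period k l n m : (k < l)%N -> hit k (n + m * (P l)%:Z) = hit k n.
Proof.
move=> kl; rewrite /hit; congr (_ && _).
  by apply/gcdz_idPl/gcdz_idPl; rewrite gcd_period.
apply: eq_forallb => i; rewrite /coprimez gcd_period //.
exact: ltn_trans kl.
Qed.

(** For [k < l] this is part of being hit; for [k = l] the common divisor is [W l] itself, which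
    exceeds 1. *)
Lemma hit_not_coprime k l n : (k <= l)%N -> hit l n -> ~~ coprimez (W k)%:Z n.
Proof.
rewrite leq_eqVlt => /predU1P[->|kl] /andP[Wn /forallP cop].
  rewrite /coprimez (gcdz_idPl Wn) /= eqz_nat.
  by apply: contraTneq (modulus_gt1 l) => ->.
exact: cop (Ordinal kl).
Qed.

Lemma rough_gcd k n : ~~ coprimez (W k)%:Z n -> (P k + k < gcdn (W k) `|n|)%N.
Proof.
rewrite coprimezE ltnNge; apply: contra => /(W_rough (dvdn_gcdl _ _)) e.
by rewrite /coprime e.
Qed.

(* For k <= l the modulus W k divides n while gcd(W k, n') <> 1, so n and n'
   share a divisor of W k, which exceeds every number up to P k + k. *)
Lemma hit_separated K k l n n' : (K <= k)%N -> (K <= l)%N ->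
  hit k n -> hit l n' -> n != n' -> (P K + K < `|n - n'|)%N.
Proof.
wlog kl : k l n n' / (k <= l)%N.
  move=> wl Kk Kl hk hl nn'; case: (leqP k l) => [|/ltnW] kl; first exact: (wl k l).
  by rewrite distnC; apply: (wl l k) => //; rewrite eq_sym.
move=> Kk Kl hk hl nn'.
have := rough_gcd (hit_not_coprime kl hl); set d := gcdn _ _ => dgt.
apply: leq_ltn_trans (roughness_mono Kk) _; apply: leq_trans dgt _.
apply: dvdn_leq; first by rewrite absz_gt0 subr_eq0.
have dn : (d%:Z %| n)%Z.
  by apply: (@dvdz_trans (W k)%:Z); [exact: dvdn_gcdl | case/andP: hk].
have dn' : (d%:Z %| n')%Z by exact: dvdn_gcdr.
by have : (d%:Z %| n - n')%Z by apply: rpredB.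
Qed.

(** Divisibility and common factors pass to multiples, so a multiple of a hit is a hit at the same
    level. Conversely, a nonzero hit [n] is a multiple of [|n|], which is also hit, and 0 is a
    multiple of [W 0]. *)
Lemma multiples_sieve n : multiples sieve n <-> exists k, hit k n.
Proof.
split.
  move=> [b [_ [k /andP[Wb cop]]] [m _ <-]]; exists k; apply/andP; split.
    exact: dvdz_mulr.
  apply/forallP => i; apply: contra (forallP cop i).
  by rewrite coprimezMr => /andP[].
move=> [k hk]; have [->|n0] := eqVneq n 0.
  exists (W 0); last by exists 0; rewrite ?mulr0.
  split; first exact: modulus_gt1.
  by exists 0%N; apply/andP; split; [exact: dvdzz | apply/forallP => -[]].
exists `|n|%N.
  split.
    apply: leq_trans (modulus_gt1 k) _; apply: dvdn_leq; rewrite ?absz_gt0 //.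
    by case/andP: hk.
  by exists k; exact: hk.
by exists (Num.sg n) => //; rewrite [RHS]numEsg -abszE mulrC.
Qed.

Lemma sieve_seqE n : Bfree_seq sieve n = ~~ `[< exists k, hit k n >].
Proof.
rewrite /Bfree_seq -asbool_neg; apply: asbool_equiv_eq.
by rewrite -multiples_sieve.
Qed.

End Sieve.

(** * The Toeplitz property and irregularity *)

Section SieveToeplitz.
Variable W : nat -> nat.
Hypothesis HW : sieving_moduli W.

Local Notation P := (period W).
Local Notation hit := (hit W).
Local Notation eta := (Bfree_seq (sieve W)).

Lemma sieve_Toeplitz : Toeplitz eta.
Proof.
move=> n; have [[k hk]|nh] := pselect (exists k, hit k n).
  exists (P k.+1); first exact: period_gt0.
  move=> m /=; rewrite !sieve_seqE //; congr (~~ _); apply: asbool_equiv_eq.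
  by split=> _; exists k => //; rewrite hit_period.
exists (P `|n|.+1); first exact: period_gt0.
move=> m /=; rewrite !sieve_seqE //; congr (~~ _); apply: asbool_equiv_eq.
split=> [//|[k]]; case: (ltnP k `|n|.+1) => [kn|/ltnW nk].
  by rewrite hit_period // => hk; exists k.
(* A translate hit at a level above [|n|] would force a common divisor of [n] and [W |n|] larger
   than [|n|]. This is absurd, as [n] is nonzero: 0 is hit at level 0. *)
move=> /(hit_not_coprime HW nk); rewrite /coprimez gcd_period //.
move=> /(rough_gcd HW); rewrite ltnNge => /negP[].
have n0 : (0 < `|n|)%N.
  rewrite absz_gt0; apply/eqP => n0; apply: nh; exists 0%N.
  by rewrite n0; apply/andP; split; [exact: dvdz0|]; apply/forallP => -[].
by rewrite (leq_trans (dvdn_leq n0 (dvdn_gcdr _ _))) ?leq_addl.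
Qed.

Lemma rough_coprime k m : (0 < m)%N -> (m <= P k + k)%N -> coprime (W k) m.
Proof.
move=> m0 mk; have [_ rough _] := HW k; rewrite /coprime; apply/eqP.
by apply: rough; [exact: dvdn_gcdl | exact: leq_trans (dvdn_leq m0 (dvdn_gcdr _ _)) mk].
Qed.

(* Otherwise a translate of n by a multiple of p * P p is hit at level p. *)
Lemma Per_sieve p n : (0 < p)%N -> Per p eta n ->
  (exists k, hit k n) \/ exists2 i, (i < p)%N & coprimez (W i)%:Z n.
Proof.
move=> p0 pern; have [|none] := pselect (exists2 i, (i < p)%N & coprimez (W i)%:Z n).
  by right.
left.
have : coprimez (W p)%:Z (p * P p)%N%:Z.
  rewrite coprimezE !absz_nat coprimeMr !rough_coprime ?leq_addl ?leq_addr //.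
  exact: period_gt0.
case/coprimezP => -[u v] /= uv.
(* With [u W_p + v p P_p = 1], the translate [n - n v p P_p] equals [n u W_p], a multiple of [W_p];
   being congruent to [n] mod [P_p], it is still coprime to no earlier modulus. *)
have := pern (- n * v * (P p)%:Z); rewrite !sieve_seqE // => /negb_inj e.
apply/asboolP; rewrite e; apply/asboolP; exists p; apply/andP; split.
  apply/dvdzP; exists (n * u).
  rewrite -[X in X + _ = _]mulr1 -uv PoszM.
  by move: (W p)%:Z p%:Z (P p)%:Z => x y z; ring.
apply/forallP => i; rewrite mulrAC /coprimez gcd_period //.
by apply/negP => ci; apply: none; exists i.
Qed.

Lemma card_Per_le p N : (0 < p)%N ->
  (#|[set i : 'I_N | `[< Per p eta (i.+1)%:Z >]]%SET| <=
   \sum_(k < N) N %/ W k + \sum_(j < p) (N %/ W j).+1 * totient (W j))%N.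
Proof.
move=> p0; have Wgt0 k : (0 < W k)%N by case: (HW k).
apply: (@leq_trans (\sum_(i < N) (\sum_(k < N) (W k %| i.+1) +
                                 \sum_(j < p) coprime (W j) i.+1))%N).
  rewrite -sum1dep_card big_mkcond leq_sum // => i _.
  case: ifPn => // /asboolP /(Per_sieve p0)[[k /andP[Wi _]]|[j jp cj]]; last first.
    rewrite (bigD1 (Ordinal jp)) //=.
    by rewrite -[X in (_ + (nat_of_bool X + _))%N]/(coprimez (W j)%:Z i.+1%:Z) cj addnCA.
  have Wi' : (W k %| i.+1)%N by [].
  (* Only levels below [N] matter, because [k < W k <= i + 1 <= N]. *)
  have kN : (k < N)%N.
    apply: leq_trans (_ : W k <= _)%N.
      by apply: leq_ltn_trans (modulus_gt HW k); rewrite leq_addl.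
    by apply: leq_trans (dvdn_leq _ Wi') (ltn_ord i).
  by rewrite (bigD1 (Ordinal kN)) //= Wi'.
rewrite big_split leq_add //= exchange_big /= leq_sum // => k _.
  by rewrite sum_dvdn.
exact: sum_coprime_le.
Qed.

(** By geometric series, the two sums bounding the count are at most [N / 4] and [N / 4 + C], and
    [C <= N / 4] for large [N]. *)
Lemma asymptotic_density_Per_le (R : realType) p : (0 < p)%N ->
  asymptotic_density R (Per p eta) <= 3 / 4.
Proof.
move=> p0; rewrite /asymptotic_density; set a := (fun N : nat => _).
(* Without convergence [limn] takes the default value 0, which satisfies the bound. *)
have [cva|/dvgP ->] := pselect (cvgn a); last by rewrite [point]/(0 : R) divr_ge0.
(* [C] collects the rounding terms from [(N %/ W j).+1] and does not depend on [N]. *)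
pose C : R := (\sum_(j < p) totient (W j))%:R.
apply: limr_le => //; near=> N.
have N0 : (0 < N)%N by near: N; exact: nbhs_infty_gt.
have CN : 4 * C <= N%:R.
  by rewrite /C -natrM ler_nat; near: N; exact: nbhs_infty_ge.
have NR : (0 : R) < N%:R by rewrite ltr0n.
have geo k : \sum_(j < k) ((2 : R) ^+ (j + 3))^-1 = 1 / 4 - ((2 : R) ^+ (k + 2))^-1.
  elim: k => [|k IHk]; first by rewrite big_ord0 add0n expr2; field.
  rewrite big_ord_recr /= IHk addSn (addnS k 2) !(exprS _ (k + 2)%N).
  have : (2 : R) ^+ (k + 2) != 0 by rewrite expf_neq0.
  by move: (_ ^+ _) => x x0; field.
have geo_le k : \sum_(j < k) ((2 : R) ^+ (j + 3))^-1 <= 1 / 4.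
  by rewrite geo gerBl invr_ge0 exprn_ge0.
have Wgt0 k : (0 : R) < (W k)%:R by rewrite ltr0n; case: (HW k).
have divW k : (N %/ W k)%:R <= N%:R / (W k)%:R :> R.
  by rewrite ler_pdivlMr // -natrM ler_nat leq_divM.
rewrite /a mulrC ler_pdivrMr //.
apply: (@le_trans _ _ ((\sum_(k < N) N %/ W k +
    \sum_(j < p) (N %/ W j).+1 * totient (W j))%N%:R)).
  by rewrite ler_nat; exact: card_Per_le.
rewrite natrD !natr_sum.
have b1 : \sum_(k < N) (N %/ W k)%:R <= N%:R * (1 / 4) :> R.
  apply: le_trans (_ : N%:R * (\sum_(k < N) ((2 : R) ^+ (k + 3))^-1) <= _); last first.
    by rewrite ler_pM2l.
  rewrite mulr_sumr; apply: ler_sum => k _; apply: le_trans (divW k) _.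
  rewrite ler_pM2l // lef_pV2 ?posrE ?exprn_gt0 // -natrX ler_nat.
  exact: modulus_large.
have b2 : \sum_(j < p) ((N %/ W j).+1 * totient (W j))%:R <= N%:R * (1 / 4) + C :> R.
  apply: le_trans (_ : N%:R * (\sum_(k < p) ((2 : R) ^+ (k + 3))^-1) + C <= _); last first.
    by rewrite lerD2r ler_pM2l.
  rewrite mulr_sumr /C natr_sum -big_split /=; apply: ler_sum => k _.
  rewrite mulSn natrD [leLHS]addrC lerD2r natrM.
  apply: le_trans (_ : N%:R / (W k)%:R * (totient (W k))%:R <= _).
    by rewrite ler_wpM2r.
  rewrite -mulrA ler_pM2l // ler_pdivrMl // -ler_pdivrMr ?exprn_gt0 ?invr_gt0 ?exprn_gt0 //.
  rewrite invrK mulrC -natrX -natrM ler_nat.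
  by case: (HW k).
by lra.
Unshelve. all: by end_near. Qed.

Lemma sieve_irregular (R : realType) : irregular_Toeplitz R eta.
Proof.
split; first exact: sieve_Toeplitz.
move=> [_ sup1]; suff : (1 : R) <= 3 / 4 by lra.
rewrite -[leLHS]sup1; apply: ge_sup.
  by exists (asymptotic_density R (Per 1 eta)); exists 1%N.
by move=> _ [p p0 <-]; exact: asymptotic_density_Per_le.
Qed.

End SieveToeplitz.

(** * Visits of the orbit to finitely determined sets *)

(* Enumerates Z as 0, -1, 1, -2, 2, ... *)
Definition zcoord (n : nat) : int := if odd n then Negz n./2 else Posz n./2.

Lemma zcoord_surj z : exists n, zcoord n = z.
Proof.
by case: z => m; [exists m.*2 | exists m.*2.+1];
  rewrite /zcoord /= ?odd_double ?doubleK ?uphalf_double.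
Qed.

Definition agree (n : nat) (y z : biseq) : Prop :=
  forall i, (i < n)%N -> y (zcoord i) = z (zcoord i).

(** These are the clopen sets of the shift; the number [n] of inspected coordinates is kept explicit
    because it enters the error bounds. *)
Definition depends_on (n : nat) (D : set biseq) : Prop :=
  forall y z, agree n y z -> D y -> D z.

Definition visits (D : set biseq) (y : biseq) (t : int) (M : nat) : nat :=
  (\sum_(j < M) `[< D (shift_pow (t + j%:Z)%R y) >])%N.

Lemma agree_sym n y z : agree n y z -> agree n z y.
Proof. by move=> yz i /yz. Qed.

Lemma agree_le n m y z : (n <= m)%N -> agree m y z -> agree n y z.
Proof. by move=> nm yz i /leq_trans/(_ nm)/yz. Qed.

Lemma depends_on_le n m D : (n <= m)%N -> depends_on n D -> depends_on m D.
Proof. by move=> nm dD y z /(agree_le nm)/dD. Qed.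

Lemma shift_powD m n y : shift_pow m (shift_pow n y) = shift_pow (m + n) y.
Proof. by apply/funext => k; rewrite /shift_pow addrA. Qed.

Lemma shift_agree n m : exists n', forall y z, agree n' y z ->
  agree n (shift_pow m y) (shift_pow m z).
Proof.
elim: n => [|n [n' IHn]]; first by exists 0%N.
have [k km] := zcoord_surj (zcoord n + m).
exists (maxn n' k.+1) => y z yz i; rewrite ltnS leq_eqVlt => /predU1P[->|].
  by rewrite /shift_pow -km; apply: yz; rewrite leq_maxr.
by apply: IHn; apply: agree_le yz; rewrite leq_maxl.
Qed.

Lemma shift_depends_on n m D : depends_on n D ->
  exists n', depends_on n' (shift_pow m @^-1` D).
Proof.
move=> dD; have [n' nn'] := shift_agree n m.
by exists n' => y z /nn'; exact: dD.
Qed.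

(** Finitely many coordinates decide the count, so every point of an orbit closure has the same
    count as some translate of the generating sequence. *)
Lemma agree_visits n D M t : depends_on n D ->
  exists n', forall y z, agree n' y z -> visits D y t M = visits D z t M.
Proof.
move=> dD; elim: M => [|M [n' IHM]].
  by exists 0%N => y z _; rewrite /visits !big_ord0.
have [m dm] := shift_depends_on (t + M%:Z) dD.
exists (maxn n' m) => y z yz; rewrite /visits !big_ord_recr /=.
congr (_ + _)%N; first by apply: IHM; apply: agree_le yz; rewrite leq_maxl.
congr nat_of_bool; apply: asbool_equiv_eq.
have ym : agree m y z by apply: agree_le yz; rewrite leq_maxr.
by split; apply: dm => //; exact: agree_sym.
Qed.

Lemma visits_shift D y s t M :
  visits D (shift_pow s y) t M = visits D y (t + s) M.
Proof.
rewrite /visits; apply: eq_bigr => j _; congr nat_of_bool.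
by rewrite shift_powD addrAC.
Qed.

(** A visit of [y] not matched by [z] requires the two to differ at one of the [n] inspected
    coordinates. *)
Lemma visits_le n D y z t M : depends_on n D ->
  (visits D y t M <= visits D z t M +
    \sum_(i < n) \sum_(j < M) (y (zcoord i + t + j%:Z)%R != z (zcoord i + t + j%:Z)%R))%N.
Proof.
move=> dD; rewrite exchange_big /visits /= -big_split leq_sum //= => j _.
have [Dy|] := asboolP (D _); last by rewrite leq0n.
have [eqyz|] := pselect (agree n (shift_pow (t + j%:Z) y) (shift_pow (t + j%:Z) z)).
  by rewrite (asboolT (dD _ _ eqyz Dy)).
move/existsNP => [i /not_implyP[ni neq]].
rewrite (bigD1 (Ordinal ni)) //= -addrA.
by case: eqP neq => // _ _; rewrite addnCA.
Qed.

(** * Balanced visits of the sieve sequence *)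

Section SieveVisits.
Variable W : nat -> nat.
Hypothesis HW : sieving_moduli W.

Local Notation P := (period W).
Local Notation hit := (hit W).
Local Notation eta := (Bfree_seq (sieve W)).

Definition sieve_approx (K : nat) : biseq :=
  fun n => ~~ `[< exists2 k, (k < K)%N & hit k n >].

Lemma sieve_approx_period K n m :
  sieve_approx K (n + m * (P K)%:Z) = sieve_approx K n.
Proof.
rewrite /sieve_approx; congr (~~ _); apply: asbool_equiv_eq.
by split=> -[k kK hk]; exists k => //; move: hk; rewrite hit_period.
Qed.

Lemma sieve_approx_neq K n : eta n != sieve_approx K n ->
  exists2 k, (K <= k)%N & hit k n.
Proof.
rewrite sieve_seqE // /sieve_approx (inj_eq negb_inj).
case: asboolP => [[k hk]|nh]; last by case: asboolP => // -[k _ hk]; case: nh; exists k.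
case: asboolP => // nh _; exists k => //.
by rewrite leqNgt; apply/negP => kK; apply: nh; exists k.
Qed.

Lemma sieve_approx_neq_uniq K t (i j : 'I_(P K)) :
  eta (t + i%:Z) != sieve_approx K (t + i%:Z) ->
  eta (t + j%:Z) != sieve_approx K (t + j%:Z) -> i = j.
Proof.
move=> ni nj; apply/eqP; apply: contraT => ij.
have [k Kk hk] := sieve_approx_neq ni; have [l Kl hl] := sieve_approx_neq nj.
have neq : t + i%:Z != t + j%:Z by rewrite (inj_eq (addrI t)) eqz_nat.
have := hit_separated HW Kk Kl hk hl neq.
by have := ltn_ord j; have := ltn_ord i; lia.
Qed.

Lemma sum_sieve_approx_neq_le1 K t :
  (\sum_(j < P K) (eta (t + j%:Z)%R != sieve_approx K (t + j%:Z)%R) <= 1)%N.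
Proof.
have [[i ni]|none] := pselect (exists j : 'I_(P K),
    eta (t + j%:Z) != sieve_approx K (t + j%:Z)); last first.
  rewrite big1 // => j _; apply/eqP; rewrite eqb0.
  by apply/negP => nj; apply: none; exists j.
rewrite (bigD1 i) //= ni big1 // => j ji; apply/eqP; rewrite eqb0.
by apply: contra ji => /(sieve_approx_neq_uniq ni) ->.
Qed.

(** Both windows are compared with the periodic approximation, whose count is the same in all
    windows of length [P K]. Each of the [n] coordinates meets at most one disagreement per window,
    so each comparison costs at most [n]. *)
Lemma sieve_visits n D K t s : depends_on n D ->
  (visits D eta t (P K) <= visits D eta s (P K) + 2 * n)%N.
Proof.
move=> dD.
have per u : visits D (sieve_approx K) u (P K) = visits D (sieve_approx K) 0 (P K).
  rewrite /visits (@sum_periodic_shift (P K)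
    (fun x => `[< D (shift_pow x (sieve_approx K)) >])).
    by apply: eq_bigr => j _; rewrite add0r.
  move=> x; congr (nat_of_bool `[< D _ >]); apply/funext => y.
  by rewrite /shift_pow addrA -[(P K)%:Z]mul1r sieve_approx_period.
have dif u : (\sum_(i < n) \sum_(j < P K) (eta (zcoord i + u + j%:Z)%R !=
    sieve_approx K (zcoord i + u + j%:Z)%R) <= n)%N.
  rewrite -[leqRHS]muln1 -[X in (X * 1)%N]card_ord -sum_nat_const leq_sum // => i _.
  exact: sum_sieve_approx_neq_le1.
apply: leq_trans (visits_le eta (sieve_approx K) t (P K) dD) _.
rewrite mul2n -addnn addnA leq_add // per -(per s).
apply: leq_trans (visits_le (sieve_approx K) eta s (P K) dD) _.
rewrite leq_add2l; apply: leq_trans (dif s).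
by apply: leq_sum => i _; apply: leq_sum => j _; rewrite eq_sym.
Qed.

Lemma period_gt K : (K < P K)%N.
Proof.
elim: K => [|K IHK]; first by rewrite /period big_ord0.
rewrite /period big_ord_recr /= -/(period W K).
apply: leq_trans (_ : P K * 2 <= _)%N; first by lia.
by rewrite leq_mul2l modulus_gt1 // orbT.
Qed.

End SieveVisits.

(** * Cylinders and Borel measures on the full shift *)

Lemma zcoord_nbhs (y : biseq) (n : int) : nbhs y [set z : biseq | z n = y n].
Proof.
have := @proj_continuous int (fun _ => bool) n y.
by move=> /(_ [set y n]); apply; rewrite nbhs_principalE.
Qed.

Lemma agree_nbhs n (y : biseq) : nbhs y [set z | agree n y z].
Proof.
elim: n => [|n IHn]; first by apply: filterS filterT => z _ i.
near=> z => i; rewrite ltnS leq_eqVlt => /predU1P[->|].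
  by apply/esym; near: z; exact: zcoord_nbhs.
by move: i; near: z.
Unshelve. all: by end_near. Qed.

Lemma nbhs_agree (y : biseq) U : nbhs y U -> exists n, [set z | agree n y z] `<=` U.
Proof.
(* The agreement sets generate a filter; its convergence to [y] in the product topology can be
   checked one coordinate at a time. *)
pose F : set_system biseq := [set U : set biseq | exists n, [set z | agree n y z] `<=` U].
have FF : ProperFilter F.
  split; first by move=> [n /(_ y)]; apply.
  split; first by exists 0%N.
    move=> A B [n nA] [m mB]; exists (maxn n m) => z yz.
    by split; [apply: nA | apply: mB]; apply: agree_le yz; rewrite ?leq_maxl ?leq_maxr.
  by move=> A B AB [n nA]; exists n => z /nA/AB.
suff Fy : F --> y by exact: Fy.
apply/cvg_sup => i; apply/cvg_image => //.
  by rewrite predeqE => b; split => // _; exists (fun=> b).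
move=> Q /=; rewrite nbhs_principalE => Qy.
have [k ki] := zcoord_surj i.
exists ([set z : biseq | Q (z i)]); last first.
  rewrite predeqE => b; split=> [[z Qz <-] //|Qb].
  by exists (fun=> b).
by exists k.+1 => z yz /=; rewrite -ki -(yz k) // ki; exact: Qy.
Qed.

Lemma depends_on_open n D : depends_on n D -> open D.
Proof.
move=> dD; rewrite openE => y Dy; apply: filterS (agree_nbhs n y) => z yz.
exact: dD Dy.
Qed.

Lemma orbit_closure_agree (w y : biseq) n : orbit_closure w y ->
  exists t, agree n y (shift_pow t w).
Proof.
by move=> /(_ _ (agree_nbhs n y))[_ [[t _ <-] yt]]; exists t.
Qed.

Lemma orbit_closure_shift (w : biseq) t : orbit_closure w (shift_pow t w).
Proof. by apply: subset_closure; exists t. Qed.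

(** Words are read along the enumeration [zcoord], so cylinders form a binary tree: appending a
    letter splits one into two. *)
Definition cylinder (s : seq bool) : set biseq :=
  [set y | forall i, (i < size s)%N -> y (zcoord i) = nth false s i].

Lemma cylinder_depends_on s : depends_on (size s) (cylinder s).
Proof. by move=> y z yz sy i si; rewrite -yz // sy. Qed.

Definition prefix_of (n : nat) (y : biseq) : seq bool := mkseq (y \o zcoord) n.

Lemma cylinder_prefix n y z : cylinder (prefix_of n y) z <-> agree n y z.
Proof.
rewrite /cylinder /= size_mkseq; split=> h i ni; first by rewrite h // nth_mkseq.
by rewrite -h // nth_mkseq.
Qed.

Lemma open_bigcup_cylinder (U : set biseq) : open U ->
  U = \bigcup_(s in [set s | cylinder s `<=` U]) cylinder s.
Proof.
rewrite openE => oU; rewrite eqEsubset; split=> [y Uy|y [s /= sU]]; last exact: sU.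
have [n nU] := nbhs_agree (oU _ Uy).
exists (prefix_of n y); last exact/cylinder_prefix.
by move=> z /cylinder_prefix/nU.
Qed.

Lemma cylinderI s s' : (size s <= size s')%N ->
  cylinder s `&` cylinder s' = cylinder s' \/ cylinder s `&` cylinder s' = set0.
Proof.
move=> ss'; have [[y [sy s'y]]|/set0P/negP] := pselect (cylinder s `&` cylinder s' !=set0).
  left; rewrite eqEsubset; split=> [z [] //|z s'z]; split=> // i si.
  by rewrite s'z ?(leq_trans si) // -s'y ?(leq_trans si) // sy.
by rewrite negbK => /eqP; right.
Qed.

(* The empty set makes this a pi-system. *)
Definition cylinders : set (set biseq) := set0 |` range cylinder.

Lemma cylinders_setI_closed : setI_closed cylinders.
Proof.
move=> A B [->|[s _ <-]]; first by rewrite set0I; left.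
move=> [->|[s' _ <-]]; first by rewrite setI0; left.
case: (leqP (size s) (size s')) => [|/ltnW] ss'; last rewrite setIC.
  by case: (cylinderI ss') => ->; [right; exists s' | left].
by case: (cylinderI ss') => ->; [right; exists s | left].
Qed.

(** Open sets are unions of cylinders, and there are only countably many cylinders. *)
Lemma cylinders_generate : (@measurable _ (borel_type biseq)) = <<s cylinders >>.
Proof.
rewrite eqEsubset; split; last first.
  apply: smallest_sub; first exact: sigma_algebra_measurable.
  move=> _ [->|[s _ <-]]; first exact: measurable0.
  by apply: sub_sigma_algebra; exact: (depends_on_open (@cylinder_depends_on s)).
apply: smallest_sub; first exact: smallest_sigma_algebra.
move=> U /open_bigcup_cylinder ->.
pose T := g_sigma_algebraType cylinders.
have -> : \bigcup_(s in [set s | cylinder s `<=` U]) cylinder s =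
  \bigcup_(s : seq bool) (if `[< cylinder s `<=` U >] then cylinder s else set0).
  rewrite eqEsubset; split=> y [s].
    by move=> /= sU sy; exists s => //; rewrite asboolT.
  by case: asboolP => // sU _ sy; exists s.
apply: (@countable_bigcupT_measurable _ T) => // s.
case: ifP => _; last exact: measurable0.
by apply: sub_sigma_algebra; right; exists s.
Qed.

Lemma depends_on_measurable n D : depends_on n D ->
  measurable (D : set (borel_type biseq)).
Proof. by move=> dD; apply: sub_sigma_algebra; apply: depends_on_open dD. Qed.

Lemma orbit_closure_measurable w :
  measurable (orbit_closure w : set (borel_type biseq)).
Proof.
rewrite -[orbit_closure w]setCK; apply: measurableC.
by apply: sub_sigma_algebra; apply: closed_openC; exact: closed_closure.
Qed.

Lemma borel_measure_unique (R : realType) (P Q : probability (borel_type biseq) R) :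
  (forall s, P (cylinder s) = Q (cylinder s)) ->
  forall A, measurable A -> P A = Q A.
Proof.
move=> PQ; apply: (@measure_unique _ R (borel_type biseq) cylinders (fun=> setT)
  _ _ _ _ P Q).
- exact: cylinders_generate.
- exact: cylinders_setI_closed.
- by move=> _; right; exists [::] => //; rewrite eqEsubset; split.
- by rewrite bigcup_const //; exists 0%N.
- by move=> _ [->|[s _ <-]]; [rewrite !measure0 | exact: PQ].
- by move=> _ /=; rewrite probability_setT ltry.
Qed.

Definition zindex (z : int) : nat :=
  match z with Posz m => m.*2 | Negz m => m.*2.+1 end.

Lemma zcoordK : cancel zcoord zindex.
Proof.
by move=> n; rewrite /zcoord; case: ifP => on /=; have := odd_double_half n;
  rewrite on ?add1n ?add0n.
Qed.

Lemma zindexK : cancel zindex zcoord.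
Proof.
by case=> m; rewrite /zcoord /= ?odd_double ?doubleK ?uphalf_double.
Qed.

Lemma cylinder_prefix_of s y : cylinder s y <-> prefix_of (size s) y = s.
Proof.
split=> [sy|<-]; last exact/cylinder_prefix.
apply: (@eq_from_nth _ false); rewrite size_mkseq // => i si.
by rewrite nth_mkseq // /= sy.
Qed.

(** * A probability with prescribed cylinder masses *)

Section CylinderMeasure.
Variables (R : realType) (mu : seq bool -> R).
Hypothesis mu_nil : mu [::] = 1.
Hypothesis mu_ge0 : forall s, 0 <= mu s.
Hypothesis mu_rcons : forall s, mu s = mu (rcons s false) + mu (rcons s true).

(* [0, 1) is cut into consecutive intervals of lengths mu s, s of length n,
   nested as n grows; lo s is the left end of the interval of s. *)
Definition lo (s : seq bool) : R :=
  \sum_(i < size s) (if nth false s i then mu (rcons (take i s) false) else 0).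

Lemma lo_rcons s b :
  lo (rcons s b) = lo s + (if b then mu (rcons s false) else 0).
Proof.
rewrite /lo size_rcons big_ord_recr /= nth_rcons ltnn eqxx.
rewrite -cats1 take_size_cat //; congr (_ + _).
apply: eq_bigr => i _; rewrite nth_cat ltn_ord.
by rewrite takel_cat // ltnW.
Qed.

Fixpoint bits (n : nat) (x : R) : seq bool :=
  if n is n'.+1 then
    rcons (bits n' x) (lo (bits n' x) + mu (rcons (bits n' x) false) <= x)
  else [::].

Lemma size_bits n x : size (bits n x) = n.
Proof. by elim: n => //= n IHn; rewrite size_rcons IHn. Qed.

Lemma nth_bits m n i x : (i < m)%N -> (i < n)%N ->
  nth false (bits m x) i = nth false (bits n x) i.
Proof.
have gen k l : (i < k)%N -> nth false (bits (l + k) x) i = nth false (bits k x) i.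
  move=> ik; elim: l => //= l IHl.
  by rewrite nth_rcons size_bits (leq_trans ik) ?leq_addl // IHl.
move=> im in_; case: (leqP m n) => [mn|/ltnW nm].
  by rewrite -(subnK mn) gen.
by rewrite -(subnK nm) gen.
Qed.

(** The interval of [rcons s b] lies inside that of [s], and the cut at [lo s + mu (rcons s false)]
    decides the last bit. *)
Lemma bits_itv x s : 0 <= x < 1 ->
  (bits (size s) x == s) = (lo s <= x < lo s + mu s).
Proof.
move=> x01; elim/last_ind: s => [|s b IHs].
  by rewrite /lo big_ord0 add0r mu_nil x01.
rewrite size_rcons /= eqseq_rcons lo_rcons.
have [e|ne] /= := boolP (bits (size s) x == s); last first.
  apply/esym/negbTE; apply: contra ne; rewrite IHs.
  have := mu_rcons s; have := mu_ge0 (rcons s true); have := mu_ge0 (rcons s false).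
  by case: b => ? ? ? /andP[? ?]; apply/andP; split; lra.
rewrite (eqP e) /=; move: e; rewrite IHs => /andP[l r].
have := mu_rcons s.
have := mu_ge0 (rcons s true); have := mu_ge0 (rcons s false).
case: b => ? ? ?; case: (leP (lo s + mu (rcons s false)) x) => ?;
  rewrite ?eqb_id ?eqbF_neg /=; apply/esym;
  by [lra | apply/andP; split=> //; lra | apply/negbTE/negP => /andP[? ?]; lra].
Qed.

Definition bit_point (x : R) : biseq :=
  fun z => nth false (bits (zindex z).+1 x) (zindex z).

Lemma prefix_bit_point n x : prefix_of n (bit_point x) = bits n x.
Proof.
apply: (@eq_from_nth _ false); rewrite size_mkseq ?size_bits // => i ni.
by rewrite nth_mkseq //= /bit_point zcoordK; exact: nth_bits.
Qed.

Lemma bits_measurable s : measurable [set x : measurableTypeR R | bits (size s) x == s].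
Proof.
elim/last_ind: s => [|s b IHs].
  by rewrite [X in measurable X](_ : _ = setT) // eqEsubset; split.
pose c := lo s + mu (rcons s false).
have -> : [set x | bits (size (rcons s b)) x == rcons s b] =
    [set x | bits (size s) x == s] `&` (if b then `[c, +oo[%classic else `]-oo, c[%classic).
  rewrite eqEsubset; split=> x; rewrite /= size_rcons /= eqseq_rcons.
    move=> /andP[e /eqP <-]; split=> //; move: e => /eqP ->; rewrite -/c.
    by case: leP => cx; rewrite /= in_itv /= ?andbT.
  move=> [/[dup] e /eqP -> cx]; rewrite eqxx -/c /=; move: cx.
  by case: b; rewrite /= in_itv /= ?andbT ?eqb_id // eqbF_neg -ltNge.
by apply: measurableI => //; case: b.
Qed.

Lemma bit_point_measurable :
  measurable_fun [set: measurableTypeR R]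
    (bit_point : measurableTypeR R -> borel_type biseq).
Proof.
apply: (@measurability _ _ (measurableTypeR R) (borel_type biseq) setT
  bit_point cylinders); first exact: cylinders_generate.
move=> _ [_ [->|[s _ <-]] <-]; rewrite setTI; first by rewrite preimage_set0.
rewrite [X in measurable X](_ : _ =
  [set x : measurableTypeR R | bits (size s) x == s]); last first.
  rewrite eqEsubset; split=> x /=.
    by move/cylinder_prefix_of; rewrite prefix_bit_point => ->.
  by move/eqP => e; apply/cylinder_prefix_of; rewrite prefix_bit_point.
exact: bits_measurable.
Qed.

HB.instance Definition _ :=
  isMeasurableFun.Build _ _ _ _ (bit_point : measurableTypeR R -> borel_type biseq)
    bit_point_measurable.

(** The image of the uniform distribution under [bit_point] works: within [[0, 1)] the preimage of
    [cylinder s] is an interval of length [mu s]. *)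
Lemma exists_probability_cylinders :
  exists Q : probability (borel_type biseq) R,
    forall s, Q (cylinder s) = (mu s)%:E.
Proof.
exists (distribution (uniform_prob (@ltr01 R))
  (bit_point : {mfun measurableTypeR R >-> borel_type biseq})) => s.
pose A : set (measurableTypeR R) := bit_point @^-1` cylinder s.
rewrite -[LHS]/(uniform_prob (@ltr01 R) A).
have AE : A = [set x : measurableTypeR R | bits (size s) x == s].
  rewrite eqEsubset; split=> x /=.
    by move/cylinder_prefix_of; rewrite prefix_bit_point => ->.
  by move/eqP => e; apply/cylinder_prefix_of; rewrite prefix_bit_point.
have mA : measurable A by rewrite AE; exact: bits_measurable.
have mfA D : measurable_fun D (fun x : measurableTypeR R => (\1_A x)%:E : \bar R).
  exact/measurable_EFinP/measurable_indic.
rewrite -[A]setIT -integral_indic // integral_uniform //.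
(* The endpoint 1, where [bits_itv] says nothing, is removed as a null set. *)
rewrite subr0 invr1 mul1e -integral_itv_bndo_bndc; last exact: mfA.
rewrite integral_indic //.
have slo : 0 <= lo s by apply: sumr_ge0 => i _; case: ifP.
have shi : lo s + mu s <= 1.
  elim/last_ind: (s) => [|t b IHt]; first by rewrite /lo big_ord0 mu_nil add0r.
  apply: le_trans IHt; rewrite lo_rcons; have := mu_rcons t.
  have := mu_ge0 (rcons t true); have := mu_ge0 (rcons t false).
  by case: b => *; lra.
rewrite (_ : A `&` _ = `[lo s, lo s + mu s[%classic); last first.
  rewrite AE eqEsubset; split=> x /=; rewrite !in_itv /=.
    by move=> [e x01]; rewrite -bits_itv.
  move=> /andP[l r].
  have x01 : 0 <= x < 1 by rewrite (le_trans slo l) (lt_le_trans r shi).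
  by rewrite bits_itv // l r.
apply: eq_trans (lebesgue_measure_itv `[lo s, lo s + mu s[) _.
rewrite /= lte_fin ltrDl -EFinD addrAC subrr add0r.
by case: ltgtP (mu_ge0 s) => // <-.
Qed.

End CylinderMeasure.

(** * Unique ergodicity *)

Lemma visitsD D y t M N :
  visits D y t (M + N) = (visits D y t M + visits D y (t + M%:Z) N)%N.
Proof.
rewrite /visits big_split_ord /=; congr (_ + _)%N.
by apply: eq_bigr => j _; rewrite PoszD addrA.
Qed.

Lemma visitsU D E y t M : D `&` E = set0 ->
  visits (D `|` E) y t M = (visits D y t M + visits E y t M)%N.
Proof.
move=> DE; rewrite /visits -big_split; apply: eq_bigr => j _ /=.
set z := shift_pow _ _; rewrite asbool_or.
case: (asboolP (D z)) => Dz; case: (asboolP (E z)) => Ez //=.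
by suff : set0 z by []; rewrite -DE.
Qed.

Lemma depends_onI n D E : depends_on n D -> depends_on n E -> depends_on n (D `&` E).
Proof. by move=> dD dE y z yz [Dy Ey]; split; [apply: dD Dy | apply: dE Ey]. Qed.

Lemma cylinder_nil : cylinder [::] = setT.
Proof. by rewrite eqEsubset; split. Qed.

Lemma cylinder_rcons s :
  cylinder s = cylinder (rcons s false) `|` cylinder (rcons s true).
Proof.
have sub b y : cylinder (rcons s b) y <-> cylinder s y /\ y (zcoord (size s)) = b.
  split=> [sy|[sy yb] i].
    split=> [i si|]; last by rewrite sy ?size_rcons // nth_rcons ltnn eqxx.
    by rewrite sy ?size_rcons 1?ltnW // nth_rcons si.
  rewrite size_rcons ltnS leq_eqVlt nth_rcons => /predU1P[->|si].
    by rewrite ltnn eqxx.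
  by rewrite si sy.
rewrite eqEsubset; split=> y; last by move=> [] /sub[].
move=> sy; case e : (y (zcoord (size s))); [right | left]; exact/sub.
Qed.

Lemma cylinder_rcons_disj s :
  cylinder (rcons s false) `&` cylinder (rcons s true) = set0.
Proof.
rewrite eqEsubset; split=> // y [/(_ (size s)) yf /(_ (size s)) yt].
by move: yf yt; rewrite !size_rcons !nth_rcons ltnn eqxx ltnSn => -> // /(_ isT).
Qed.

Lemma left_shift_measurable :
  measurable_fun setT (left_shift : borel_type biseq -> borel_type biseq).
Proof.
apply: (@measurability _ _ (borel_type biseq) (borel_type biseq) setT left_shift cylinders).
  exact: cylinders_generate.
move=> _ [_ [->|[s _ <-]] <-]; rewrite setTI; first by rewrite preimage_set0.
have [n dn] := shift_depends_on 1 (@cylinder_depends_on s).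
exact: depends_on_measurable dn.
Qed.

HB.instance Definition _ := isMeasurableFun.Build _ _ _ _
  (left_shift : borel_type biseq -> borel_type biseq) left_shift_measurable.

(** * Frequencies along a balanced sequence *)

Section Balanced.
Variables (R : realType) (w : biseq) (p : nat -> nat).
Hypothesis p_gt : forall k, (k < p k)%N.
Hypothesis p_dvd : forall k l, (k <= l)%N -> (p k %| p l)%N.
Hypothesis visits_balanced : forall n D k t s, depends_on n D ->
  (visits D w t (p k) <= visits D w s (p k) + 2 * n)%N.

Local Notation X := (orbit_closure w).

Let p_gt0 k : (0 < p k)%N. Proof. exact: leq_ltn_trans (p_gt k). Qed.
Let pR_gt0 k : 0 < (p k)%:R :> R. Proof. by rewrite ltr0n. Qed.

Definition freq (D : set biseq) (k : nat) : R := (visits D w 0 (p k))%:R / (p k)%:R.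

Lemma visits_mul n D k q t s : depends_on n D ->
  (visits D w t (q * p k) <= q * (visits D w s (p k) + 2 * n))%N /\
  (q * visits D w s (p k) <= visits D w t (q * p k) + q * (2 * n))%N.
Proof.
move=> dD; elim: q t => [|q IHq] t; first by rewrite !mul0n /visits !big_ord0.
rewrite !(mulSn q) visitsD; have [h1 h2] := IHq (t + (p k)%:Z).
have h3 := visits_balanced k t s dD; have h4 := visits_balanced k s t dD.
split; first exact: leq_add h3 h1.
by rewrite addnACA; exact: leq_add h4 h2.
Qed.

(** As [p k] divides [p l], the frequency at stage [l] averages those of blocks of length [p k],
    each within [2 n / p k] of the first one. *)
Lemma freq_dist n D k l : depends_on n D -> (k <= l)%N ->
  `|freq D l - freq D k| <= (2 * n)%:R / (p k)%:R.
Proof.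
move=> dD /p_dvd/dvdnP[q pl].
have q0 : (0 < q)%N by have := p_gt0 l; rewrite pl muln_gt0 => /andP[].
have qR : 0 < q%:R :> R by rewrite ltr0n.
have [h1 h2] := visits_mul k q 0 0 dD.
rewrite /freq pl natrM invfM mulrA -mulrBl normrM [`|_^-1|]gtr0_norm ?invr_gt0 //.
rewrite ler_pM2r ?invr_gt0 // ler_norml.
apply/andP; split.
  rewrite lerBrDr -[leLHS](mulfK (lt0r_neq0 qR)) ler_pM2r ?invr_gt0 //.
  move: h2; rewrite -(ler_nat R) natrM natrD [(q * (2 * n))%:R]natrM; lra.
rewrite lerBlDr ler_pdivrMr //.
by move: h1; rewrite -(ler_nat R) natrM natrD mulrC addrC.
Qed.

Lemma bound_cvg0 (C : R) : C / (p k)%:R @[k --> \oo] --> 0.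
Proof.
rewrite -[X in _ --> X](mulr0 C); apply: cvgM; first exact: cvg_cst.
apply: (@squeeze_cvgr _ _ _ _ (fun=> 0) (@harmonic R)); last 2 first.
- exact: cvg_cst.
- exact: cvg_harmonic.
by apply: nearW => k; rewrite invr_ge0 ler0n /= lef_pV2 ?posrE // ler_nat.
Qed.

Lemma freq_cvg n D : depends_on n D -> cvgn (freq D).
Proof.
move=> dD; apply/cauchy_cvgP/cauchy_exP => e e0.
have /cvgrPdist_lt/(_ _ e0)[K _ hK] := bound_cvg0 (2 * n)%:R.
exists (freq D K); exists K => // l /= Kl; rewrite /ball /= distrC.
apply: le_lt_trans (freq_dist dD Kl) _.
by have := hK K (leqnn K); rewrite sub0r normrN => /(le_lt_trans (ler_norm _)).
Qed.

Definition mass (D : set biseq) : R := limn (freq D).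

(** This identifies a limit from finite-stage estimates; it serves both for shift invariance and for
    computing an arbitrary invariant probability. *)
Lemma mass_uniq D (C x : R) :
  (forall k, `|x - freq D k| <= C / (p k)%:R) -> x = mass D.
Proof.
move=> xD; apply/esym/cvg_lim => //.
apply/cvgrPdist_lt => e e0.
have /cvgrPdist_lt/(_ _ e0)[K _ hK] := bound_cvg0 C.
exists K => // l /= Kl; apply: le_lt_trans (xD l) _.
by have := hK l Kl; rewrite sub0r normrN => /(le_lt_trans (ler_norm _)).
Qed.

Lemma mass_dist n D k : depends_on n D ->
  `|mass D - freq D k| <= (2 * n)%:R / (p k)%:R.
Proof.
move=> dD.
have h : `|freq D l - freq D k| @[l --> \oo] --> `|mass D - freq D k|.
  by apply: cvg_norm; apply: cvgB; [exact: freq_cvg dD | exact: cvg_cst].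
rewrite -(cvg_lim _ h) //; apply: limr_le; first by apply/cvg_ex; eexists; exact: h.
by exists k => // l /= kl; exact: freq_dist.
Qed.

Lemma massU n D E : depends_on n D -> depends_on n E -> D `&` E = set0 ->
  mass (D `|` E) = mass D + mass E.
Proof.
move=> dD dE DE; rewrite /mass -limD; [|exact: freq_cvg dD|exact: freq_cvg dE].
by congr (limn _); apply/funext => k; rewrite /freq visitsU // natrD mulrDl.
Qed.

Lemma mass_ge0 n D : depends_on n D -> 0 <= mass D.
Proof.
move=> dD; apply: limr_ge; first exact: freq_cvg dD.
by apply: nearW => k; rewrite divr_ge0.
Qed.

Lemma mass_unvisited D : (forall t, ~ D (shift_pow t w)) -> mass D = 0.
Proof.
move=> nD; apply/esym/(@mass_uniq _ 0) => k.
rewrite /freq /visits big1 ?mul0r ?subrr ?normr0 // => j _.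
by case: asboolP => // /nD.
Qed.

Lemma mass_setT : mass setT = 1.
Proof.
apply/esym/(@mass_uniq _ 0) => k; rewrite /freq /visits.
under eq_bigr do rewrite asboolT //.
by rewrite sum1_card card_ord divff ?gt_eqF // subrr normr0 mul0r.
Qed.

Lemma mass_cylinder_rcons s :
  mass (cylinder s) = mass (cylinder (rcons s false)) + mass (cylinder (rcons s true)).
Proof.
rewrite cylinder_rcons (@massU (size s).+1) //; last exact: cylinder_rcons_disj.
  by rewrite -(size_rcons s false); exact: cylinder_depends_on.
by rewrite -(size_rcons s true); exact: cylinder_depends_on.
Qed.

Lemma mass_shift n D : depends_on n D -> mass (left_shift @^-1` D) = mass D.
Proof.
move=> dD; have [n' dn'] := shift_depends_on 1 dD.
(* The term [2 n'] is the convergence error for the shifted set, and [2 n] compares the windows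
   starting at 0 and 1. *)
apply: (@mass_uniq _ ((2 * n')%:R + (2 * n)%:R)) => k.
apply: le_trans (ler_distD (freq (left_shift @^-1` D) k) _ _) _.
rewrite mulrDl lerD //; first exact: mass_dist dn'.
have -> : freq (left_shift @^-1` D) k = (visits D w 1 (p k))%:R / (p k)%:R.
  rewrite /freq /visits; congr (_%:R / _); apply: eq_bigr => j _.
  by rewrite /left_shift /= shift_powD add0r.
rewrite -mulrBl normrM [`|_^-1|]gtr0_norm ?invr_gt0 // ler_pM2r ?invr_gt0 //.
have := visits_balanced k 0 1 dD; have := visits_balanced k 1 0 dD.
by rewrite -!(ler_nat R) !natrD ler_norml => ? ?; apply/andP; split; lra.
Qed.

(** The visit count over [p k] steps is integrated over [X]. By invariance the integral is [p k]
    times [Q D]; by balance the integrand stays within [2 n] of the count for [w]. *)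
Lemma invariant_probability_mass (Q : probability (borel_type biseq) R) s :
  invariant_probability X left_shift Q -> Q (cylinder s) = (mass (cylinder s))%:E.
Proof.
move=> [QX Qinv]; set D := cylinder s; pose n := size s.
have dD : depends_on n D by exact: cylinder_depends_on.
have mS (j : int) : measurable (shift_pow j @^-1` D : set (borel_type biseq)).
  by have [n' dn'] := shift_depends_on j dD; exact: depends_on_measurable dn'.
pose Y : set (borel_type biseq) := X.
have mX : measurable Y by exact: orbit_closure_measurable.
have QD (j : nat) : Q (shift_pow j%:Z @^-1` D) = Q D.
  elim: j => [|j IHj].
    congr (Q _); rewrite eqEsubset; split=> y;
      by rewrite /= (_ : shift_pow 0 y = y) //; apply/funext => z; rewrite /shift_pow addr0.
  rewrite -IHj -[RHS]Qinv //; congr (Q _).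
  by rewrite eqEsubset; split=> y; rewrite /= /left_shift shift_powD -PoszD addn1.
(* The complement of [X] is null, so integrals over [X] see the full mass. *)
have QIX (A : set (borel_type biseq)) : measurable A -> Q (A `&` Y) = Q A.
  move=> mA; rewrite -[in RHS](setIT A) -(setUv Y) setIUr measureU //; last 3 first.
  - exact: measurableI.
  - by apply: measurableI => //; exact: measurableC.
  - by rewrite setIACA setICr setI0.
  rewrite -[LHS]adde0; congr (_ + _)%E; apply/esym/eqP; rewrite eq_le measure_ge0 andbT.
  apply: le_trans (le_measure _ _ _ (@subIsetr _ A (~` Y))) _.
  - by rewrite inE; apply: measurableI => //; exact: measurableC.
  - by rewrite inE; exact: measurableC.
  by have : (Q (~` Y) <= 0)%E by rewrite probability_setC // QX subee.
have Qfin : Q D \is a fin_num by apply: fin_num_measure; exact: depends_on_measurable dD.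
rewrite -(fineK Qfin); congr (_%:E).
apply: (@mass_uniq _ (2 * n)%:R) => k.
set v := visits D w 0 (p k).
pose f (y : biseq) : \bar R := (\sum_(j < p k) (\1_(shift_pow j%:Z @^-1` D) y)%:E)%E.
have fE y : f y = (visits D y 0 (p k))%:R%:E.
  by rewrite /f sumEFin /visits natr_sum; congr (_%:E).
have mf j : measurable_fun Y
    (fun y : borel_type biseq => (\1_(shift_pow j @^-1` D) y)%:E : \bar R).
  exact/measurable_EFinP/measurable_indic.
have intf : (\int[Q]_(y in Y) f y = ((p k)%:R * fine (Q D))%:E)%E.
  rewrite /f ge0_integral_sum //.
  transitivity (\sum_(j < p k) Q D)%E.
    apply: eq_bigr => j _; rewrite integral_indic //.
    exact: (eq_trans (QIX _ (mS j)) (QD j)).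
  by rewrite -(fineK Qfin) sumEFin big_const_ord iter_addr_0 mulr_natl.
have mfX : measurable_fun Y (f : borel_type biseq -> \bar R).
  by apply: emeasurable_sum => j; exact: mf.
have vis y : X y -> exists t, visits D y 0 (p k) = visits D w t (p k).
  move=> Xy; have [m hm] := agree_visits (p k) 0 dD.
  have [t yt] := orbit_closure_agree m Xy.
  by exists (0 + t); rewrite (hm _ _ yt) visits_shift.
have up : (p k)%:R * fine (Q D) <= v%:R + (2 * n)%:R.
  rewrite -lee_fin -intf -[leRHS]mule1 -QX -(integral_cst _ mX).
  apply: ge0_le_integral => //.
  - by move=> y _; rewrite fE lee_fin.
  - move=> y Xy; rewrite fE lee_fin -natrD ler_nat.
    by have [t ->] := vis y Xy; exact: visits_balanced.
(* Truncated subtraction keeps the lower bound nonnegative, as monotonicity of the nonnegative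
   integral requires. *)
have low : (v - 2 * n)%N%:R <= (p k)%:R * fine (Q D).
  rewrite -lee_fin -intf -[leLHS]mule1 -QX -(integral_cst _ mX).
  apply: ge0_le_integral => //.
  - by move=> y _; rewrite lee_fin.
  - move=> y Xy; rewrite fE lee_fin ler_nat; have [t ->] := vis y Xy.
    by have := visits_balanced k 0 t dD; rewrite -/v; lia.
have vn : v%:R <= (v - 2 * n)%N%:R + (2 * n)%:R :> R.
  by rewrite -natrD ler_nat; lia.
rewrite /freq -/v -[fine _](mulfK (lt0r_neq0 (pR_gt0 k))) -mulrBl normrM.
rewrite [`|_^-1|]gtr0_norm ?invr_gt0 // ler_pM2r ?invr_gt0 // ler_norml.
by apply/andP; split; lra.
Qed.

(** [D] is cut by longer and longer cylinders; once their words have length [n], each piece is a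
    whole cylinder or empty, and additivity of both sides climbs back up. *)
Lemma probability_mass (Q : probability (borel_type biseq) R) n D :
  (forall s, Q (cylinder s) = (mass (cylinder s))%:E) ->
  depends_on n D -> Q D = (mass D)%:E.
Proof.
move=> Qs dD.
suff gen m s : (size s + m)%N = n -> Q (D `&` cylinder s) = (mass (D `&` cylinder s))%:E.
  by have := gen n [::] erefl; rewrite cylinder_nil setIT.
elim: m s => [|m IHm] s.
  rewrite addn0 => sn.
  have [[y [Dy sy]]|/set0P/negP] := pselect (D `&` cylinder s !=set0).
    rewrite (_ : D `&` _ = cylinder s) // eqEsubset; split=> [z []//|z sz].
    split=> //; apply: dD Dy => i; rewrite -sn => si.
    by rewrite sy // sz.
  rewrite negbK => /eqP ->; rewrite measure0 mass_unvisited // => t; exact.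
move=> smn.
have E b : (size (rcons s b) + m = n)%N by rewrite size_rcons -smn addSnnS.
have dr b : depends_on n (D `&` cylinder (rcons s b)).
  apply: depends_onI => //; apply: depends_on_le (@cylinder_depends_on _).
  by rewrite -(E b) leq_addr.
have disj : (D `&` cylinder (rcons s false)) `&` (D `&` cylinder (rcons s true)) = set0.
  by rewrite setIACA cylinder_rcons_disj setI0.
rewrite cylinder_rcons setIUr (massU (dr false) (dr true) disj) measureU //.
- by rewrite EFinD; congr (_ + _)%E; apply: IHm; exact: E.
- exact: depends_on_measurable (dr false).
- exact: depends_on_measurable (dr true).
Qed.

(** The limiting frequencies are the cylinder masses of a probability, and every invariant
    probability has the same cylinder masses. *)
Lemma balanced_uniquely_ergodic : uniquely_ergodic R X left_shift.
Proof.
have [|||Q Qs] := @exists_probability_cylinders R (fun s => mass (cylinder s)).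
- by rewrite cylinder_nil mass_setT.
- by move=> s; apply: mass_ge0; exact: cylinder_depends_on.
- exact: mass_cylinder_rcons.
exists Q; split; last first.
  move=> Q' iQ'; apply: borel_measure_unique => s.
  by rewrite Qs; exact: invariant_probability_mass.
split; last first.
  move=> A mA.
  apply: (@borel_measure_unique R
    (distribution Q (left_shift : {mfun borel_type biseq >-> borel_type biseq})) Q) => // s.
  have [n dn] := shift_depends_on 1 (@cylinder_depends_on s).
  rewrite -[LHS]/(Q (left_shift @^-1` cylinder s)) (probability_mass Qs dn) Qs.
  by rewrite (mass_shift (@cylinder_depends_on s)).
have mX : measurable (X : set (borel_type biseq)) by exact: orbit_closure_measurable.
suff Q0 : Q (~` X) = 0%E.
  have := probability_setC Q (measurableC mX); rewrite setCK => ->.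
  by rewrite [X in (1 - X)%E]Q0 sube0.
(* The open complement of [X] is a countable union of cylinders missing [X]; the orbit of [w] never
   enters them, so their mass is 0. *)
pose F (i : nat) : set (borel_type biseq) :=
  if unpickle i is Some s then
    if `[< cylinder s `<=` ~` X >] then cylinder s else set0
  else set0.
have FE : ~` X = \bigcup_i F i.
  have oX : open (~` X) by apply: closed_openC; exact: closed_closure.
  rewrite {1}(open_bigcup_cylinder oX) eqEsubset; split=> y.
    by move=> [s /= sX sy]; exists (pickle s) => //; rewrite /F pickleK asboolT.
  move=> [i _]; rewrite /F; case: unpickle => // s; case: asboolP => // sX sy.
  by exists s.
suff : Q.-negligible (~` X : set (borel_type biseq)).
  by move/(@negligibleP _ _ _ Q _ (measurableC mX)).
rewrite FE; apply: negligible_bigcup => i.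
rewrite /F; case: unpickle => [s|]; last exact: negligible_set0.
case: asboolP => sX; last exact: negligible_set0.
apply/(@negligibleP _ _ _ Q); first exact: depends_on_measurable (@cylinder_depends_on s).
rewrite [LHS]Qs mass_unvisited // => t /sX; apply; exact: orbit_closure_shift.
Qed.

End Balanced.

(** * Entropy *)

Lemma zcoord_bound c m : (c < m)%N -> - m%:Z <= zcoord c < m%:Z.
Proof.
rewrite /zcoord; case: ifP => oc cm; have := odd_double_half c; rewrite oc; lia.
Qed.

Lemma iter_left_shift i y : iter i left_shift y = shift_pow i%:Z y.
Proof.
elim: i => [|i IHi]; last by rewrite iterS IHi /left_shift shift_powD -PoszD add1n.
by apply/funext => z; rewrite /shift_pow addr0.
Qed.

Lemma biseq_compact : compact [set: biseq].
Proof.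
have := @tychonoff int (fun=> bool) (fun=> setT) (fun=> bool_compact).
by rewrite (_ : [set f | _] = setT) // eqEsubset; split.
Qed.

(** * Cover numbers and factor counts *)

Section Factors.
Variable w : biseq.
Local Notation X := (orbit_closure w).

Lemma orbit_closure_shift_stable t y : X y -> X (shift_pow t y).
Proof.
move=> Xy V /nbhs_agree[n nV]; have [m nm] := shift_agree n t.
have [s ys] := orbit_closure_agree m Xy.
exists (shift_pow (t + s) w); split; first by exists (t + s).
by apply: nV; rewrite /= -shift_powD; exact: nm.
Qed.

Definition factor (l : nat) (y : biseq) (t : int) : {ffun 'I_l -> bool} :=
  [ffun j : 'I_l => y (t + j%:Z)].

Definition factors (l : nat) : {set {ffun 'I_l -> bool}} :=
  [set u | `[< exists t, u = factor l w t >]]%SET.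

Lemma orbit_closure_factor l y t : X y -> factor l y t \in factors l.
Proof.
pose n := (\max_(j < l) (zindex (t + j%:Z)).+1)%N.
move=> Xy; have [s ys] := orbit_closure_agree n Xy.
rewrite inE; apply/asboolP; exists (t + s); apply/ffunP => j; rewrite !ffunE.
rewrite -[t + j%:Z]zindexK ys; first by rewrite zindexK /shift_pow addrAC.
exact: (leq_bigmax (F := fun j : 'I_l => (zindex (t + j%:Z)).+1) j).
Qed.

(** Compactness of [X] provides [m], which plays the part of a Lebesgue number of the cover. *)
Lemma open_cover_agree (U : set (set biseq)) : open_cover X U ->
  exists m, forall y, X y -> exists2 A, U A & [set z | agree m y z] `<=` A.
Proof.
move=> [oU XU].
have /compact_near_coveringP cX : compact X.
  by apply: subclosed_compact biseq_compact _ => //; exact: closed_closure.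
pose P (m : nat) (y : biseq) := exists2 A, U A & [set z | agree m y z] `<=` A.
have [|m _ hm] := cX nat \oo P _; last by exists m => y; exact: (hm m (leqnn m)).
move=> x Xx; have [A UA Ax] := XU _ Xx.
have [n nA] : exists n, [set z | agree n x z] `<=` A.
  by apply: nbhs_agree; move: (oU _ UA); rewrite openE; exact.
exists ([set z | agree n x z], [set m | (n <= m)%N]).
  by split; [exact: agree_nbhs | exists n].
move=> [y m] [/= xy nm]; exists A => // z yz; apply: nA => i ni.
by rewrite xy // yz // (leq_trans ni).
Qed.

(** The coordinates in [[-m, n + m)] determine which cover members may be used at all times below
    [n], so one member of the join per factor of length [n + 2 m] suffices. *)
Lemma cover_number_join_le (R : realType) (U : set (set biseq)) : open_cover X U ->
  exists m, forall n,
    (cover_number R X (cover_join left_shift U n) <= #|factors (n + 2 * m)|%:R%:E)%E.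
Proof.
move=> cU; have [m mU] := open_cover_agree cU; exists m => n.
set l := (n + 2 * m)%N.
have key (k : 'I_#|factors l|) : exists A : nat -> set biseq, (forall i, U (A i)) /\
    forall y, X y -> factor l y (- m%:Z) = enum_val k ->
    forall i, (i < n)%N -> A i (shift_pow i%:Z y).
  have := enum_valP k; rewrite inE => /asboolP[t kt].
  (* A point of the orbit showing the [k]-th factor on the window; the members [A i] are chosen
     around its translates. *)
  pose x := shift_pow (t + m%:Z) w.
  have xk : factor l x (- m%:Z) = enum_val k.
    by rewrite kt; apply/ffunP => j; rewrite !ffunE /x /shift_pow; congr w; lia.
  have Xx : X x by exact: orbit_closure_shift.
  have /choice[A hA] (i : nat) : exists A, U A /\
      [set z | agree m (shift_pow i%:Z x) z] `<=` A.
    by have [A UA hA] := mU _ (@orbit_closure_shift_stable i%:Z _ Xx); exists A.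
  exists A; split=> [i|y Xy yk i ni]; first by case: (hA i).
  case: (hA i) => _; apply => c cm; rewrite /shift_pow.
  have /andP[c1 c2] := zcoord_bound cm.
  have jl : (absz (zcoord c + i%:Z + m%:Z)%R < l)%N by rewrite /l; lia.
  have := congr1 (fun f : {ffun 'I_l -> bool} => f (Ordinal jl)) (etrans xk (esym yk)).
  rewrite !ffunE /= (_ : - m%:Z + _ = zcoord c + i%:Z) //.
  by rewrite gez0_abs; lia.
have /choice[A hA] := key.
apply: ereal_inf_lbound; exists #|factors l| => //.
exists (fun k => \bigcap_(i in `I_n) (iter i left_shift @^-1` A k i)).
split=> [k|y Xy]; first by exists (A k) => //; case: (hA k).
have yl := orbit_closure_factor l (- m%:Z) Xy.
exists (enum_rank_in yl (factor l y (- m%:Z))) => // i ni /=.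
rewrite iter_left_shift; case: (hA (enum_rank_in yl (factor l y (- m%:Z)))) => _.
by apply => //; rewrite enum_rankK_in.
Qed.

Lemma cover_number_ge1 (R : realType) (U : set (set biseq)) :
  (1 <= cover_number R X U)%E.
Proof.
apply: le_ereal_inf_tmp => _ [[|n] [A [_ XA]] <-]; last by rewrite lee_fin ler1n.
by have [[]] := XA _ (@orbit_closure_shift w 0).
Qed.

Lemma card_factors_gt0 l : (0 < #|factors l|)%N.
Proof.
apply/card_gt0P; exists (factor l w 0); rewrite inE; apply/asboolP; by exists 0.
Qed.

Lemma entropy_eq0 (R : realType) :
  (forall e : R, 0 < e -> exists C : R,
     forall l, ln #|factors l|%:R <= C + e * l%:R) ->
  topological_entropy R X left_shift = 0%E.
Proof.
move=> growth; apply/eqP; rewrite eq_le; apply/andP; split; last first.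
  (* The trivial cover already gives the lower bound 0, cover numbers being at least 1. *)
  apply: (@le_trans _ _ (cover_entropy R X left_shift [set setT])); last first.
    apply: ereal_sup_ubound; exists [set setT] => //; split.
      by move=> _ ->; exact: openT.
    by move=> y _; exists setT.
  apply: le_ereal_inf_tmp => _ [V /filter_ex[n Vn] <-].
  apply: (@le_trans _ _ ((n%:R^-1)%:E * lne (cover_number R X
      (cover_join left_shift [set setT] n)))%E).
    by apply: mule_ge0; rewrite ?lee_fin ?invr_ge0 // lne_ge0 cover_number_ge1.
  by apply: ereal_sup_ubound; exists n.
apply: ge_ereal_sup => _ [U cU <-].
have [m mU] := cover_number_join_le R cU.
apply/lee_addgt0Pr => e e0; rewrite add0e.
have e20 : 0 < e / 2 by rewrite divr_gt0.
have [C hC] := growth _ e20.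
(* [C'] bounds the part not growing with [n]. From [N] on it is at most [n e / 2], which leaves
   [e / 2] for the linear part; starting at [N.+1] also keeps [n] positive. *)
pose C' := `|C| + e / 2 * (2 * m)%:R.
have [N CN] : exists N : nat, C' / (e / 2) <= N%:R.
  exists (Num.bound (C' / (e / 2))); apply/ltW/archi_boundP/divr_ge0/ltW => //.
  by apply: addr_ge0 => //; apply: mulr_ge0 => //; exact: ltW.
apply: (@le_trans _ _ (ereal_sup [set ((n%:R^-1)%:E * lne (cover_number R X
      (cover_join left_shift U n)))%E | n in [set n | (N.+1 <= n)%N]])).
  by apply: ereal_inf_lbound; exists [set n | (N.+1 <= n)%N] => //; exists N.+1.
apply: ge_ereal_sup => _ [n /= Nn <-].
have nR : (0 : R) < n%:R by rewrite ltr0n (leq_trans _ Nn).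
have F0 : (0 : R) < #|factors (n + 2 * m)|%:R by rewrite ltr0n card_factors_gt0.
apply: (@le_trans _ _ ((n%:R^-1)%:E * lne #|factors (n + 2 * m)|%:R%:E)%E).
  apply: lee_wpmul2l; first by rewrite lee_fin invr_ge0.
  rewrite lee_lne ?mU // in_itv /= leey andbT.
    by apply: le_trans (cover_number_ge1 _ _); rewrite lee_fin.
  by rewrite lee_fin ltW.
rewrite lne_EFin // -EFinM lee_fin mulrC ler_pdivrMr //.
apply: le_trans (hC _) _; rewrite natrD mulrDr.
have : C' <= n%:R * (e / 2).
  rewrite -ler_pdivrMr //; apply: le_trans CN _; rewrite ler_nat; exact: ltnW.
rewrite /C'; have := ler_norm C; move: (e / 2 * _%:R) => ?; lra.
Qed.

End Factors.

(** * Factor complexity of the sieve sequence *)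

Section SieveFactors.
Variable W : nat -> nat.
Hypothesis HW : sieving_moduli W.

Local Notation P := (period W).
Local Notation eta := (Bfree_seq (sieve W)).

(* A factor of eta of length l is determined by its position modulo P K and, in
   each of its blocks of length P K, the at most one place where eta differs
   from its P K-periodic approximation. *)
Lemma card_sieve_factors_le K l :
  (#|factors eta l| <= P K * (P K).+1 ^ (l %/ P K).+1)%N.
Proof.
have P0 : (0 < P K)%N by exact: period_gt0.
pose q := (l %/ P K).+1.
have jq (j : 'I_l) : (j %/ P K < q)%N by rewrite ltnS leq_div2r // ltnW.
have jr (j : 'I_l) : (j %% P K < P K)%N by rewrite ltn_mod.
pose code := ('I_(P K) * {ffun 'I_q -> option 'I_(P K)})%type.
(* Decoding flips the periodic approximation at the place recorded for each block; the last of the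
   [q] blocks may be incomplete. *)
pose decode (c : code) : {ffun 'I_l -> bool} := [ffun j : 'I_l =>
  sieve_approx W K (c.1%:Z + j%:Z) (+) (c.2 (Ordinal (jq j)) == Some (Ordinal (jr j)))].
have <- : #|{: code}| = (P K * (P K).+1 ^ q)%N.
  by rewrite card_prod card_ffun card_option !card_ord.
apply: leq_trans (leq_imset_card decode _); apply: subset_leq_card.
apply/fintype.subsetP => u; rewrite inE => /asboolP[t ->]; apply/imsetP.
have PZ : (P K)%:Z != 0 by rewrite eqz_nat -lt0n.
have tr : (absz (t %% (P K)%:Z)%Z < P K)%N.
  by rewrite -ltz_nat gez0_abs ?modz_ge0 // ltz_pmod.
pose neq x := eta x != sieve_approx W K x.
pose g := [ffun b : 'I_q => [pick i : 'I_(P K) | neq (t + (b * P K)%N%:Z + i%:Z)]].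
exists (Ordinal tr, g) => //; apply/ffunP => j; rewrite !ffunE /=.
have -> : sieve_approx W K ((absz (t %% (P K)%:Z)%Z)%:Z + j%:Z) =
    sieve_approx W K (t + j%:Z).
  rewrite gez0_abs ?modz_ge0 // [in RHS](divz_eq t (P K)%:Z).
  by rewrite -[in RHS]addrA addrC sieve_approx_period.
have tj : t + (j %/ P K * P K)%N%:Z + (j %% P K)%N%:Z = t + j%:Z.
  by rewrite -addrA -PoszD -divn_eq.
case: pickP => [i ni|none].
  have [e|ne] := eqVneq i (Ordinal (jr j)).
    rewrite e eqxx; move: ni; rewrite e /= tj /neq.
    by case: (eta _); case: sieve_approx.
  have -> : (Some i == Some (Ordinal (jr j))) = false by apply/negbTE.
  rewrite addbF; apply/eqP; apply: contraNT ne => nj; apply/eqP.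
  by apply: (sieve_approx_neq_uniq HW ni) => /=; rewrite tj.
rewrite addbF; apply/eqP; move: (none (Ordinal (jr j))) => /= /negbT.
by rewrite tj negbK.
Qed.

(** With [p = P K], one has [exp(e p) >= (1 + e p / 2)^2 >= 1 + p] as soon as [p >= 4 / e^2]. *)
Lemma ln_period_small (R : realType) (e : R) : 0 < e ->
  exists K, ln (P K).+1%:R <= e * (P K)%:R.
Proof.
move=> e0; pose K := Num.bound (4 / e ^+ 2); exists K.
have PK : 4 / e ^+ 2 <= (P K)%:R.
  apply: (@le_trans _ _ K%:R).
    by apply/ltW/archi_boundP; rewrite divr_ge0 // exprn_ge0 // ltW.
  by rewrite ler_nat ltnW // period_gt.
set p : R := (P K)%:R in PK *.
have p0 : 0 < p by rewrite ltr0n; exact: period_gt0.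
rewrite -[leRHS]expRK ler_ln ?posrE ?expR_gt0 ?ltr0n //.
have -> : e * p = e * p / 2 + e * p / 2 by rewrite -splitr.
rewrite expRD -natr1 -/p.
have h := expR_ge1Dx (e * p / 2).
have ep : 0 <= e * p / 2 by rewrite divr_ge0 // mulr_ge0 // ltW.
apply: (@le_trans _ _ ((1 + e * p / 2) * (1 + e * p / 2))); last first.
  by apply: ler_pM => //; rewrite addr_ge0.
have : p <= (e * p / 2) * (e * p / 2).
  have -> : e * p / 2 * (e * p / 2) = (e ^+ 2 * p) / 4 * p by field.
  rewrite ler_peMl ?(ltW p0) // ler_pdivlMr // mul1r.
  by rewrite mulrC -ler_pdivrMr ?exprn_gt0.
by lra.
Qed.

Lemma sieve_entropy_eq0 (R : realType) :
  topological_entropy R (orbit_closure eta) left_shift = 0%E.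
Proof.
apply: entropy_eq0 => e e0; have [K hK] := ln_period_small e0.
have P0 : (0 < P K)%N by exact: period_gt0.
(* The exponent [l / P K] is exceeded by 2: once for the incomplete block and once for the factor
   [P K], bounded by [P K + 1]. *)
exists (2 * ln (P K).+1%:R) => l.
have L0 : (0 : R) < (P K).+1%:R by rewrite ltr0n.
have q1 : (l %/ P K)%:R * ln (P K).+1%:R <= e * l%:R :> R.
  apply: (@le_trans _ _ ((l %/ P K)%:R * (e * (P K)%:R))); first by rewrite ler_wpM2l.
  by rewrite mulrCA ler_pM2l // -natrM ler_nat leq_divM.
apply: (@le_trans _ _ (ln ((P K).+1%:R ^+ (l %/ P K).+2))).
  rewrite ler_ln ?posrE ?exprn_gt0 // ?ltr0n ?card_factors_gt0 //.
  rewrite -natrX ler_nat; apply: leq_trans (card_sieve_factors_le K l) _.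
  by rewrite [leqRHS]expnS leq_mul2r leqnSn orbT.
rewrite lnXn // (mulrS _ (l %/ P K).+1) (mulrS _ (l %/ P K)).
rewrite -[_ *+ (l %/ P K)]mulr_natl; lra.
Qed.

End SieveFactors.

Theorem theorem2 (R : realType) :
  exists B : set nat,
    (forall b : nat, B b -> (1 < b)%N) /\
    irregular_Toeplitz R (Bfree_seq B) /\
    uniquely_ergodic R (orbit_closure (Bfree_seq B)) left_shift /\
    topological_entropy R (orbit_closure (Bfree_seq B)) left_shift = 0%E.
Proof.
have [W HW] := exists_sieving_moduli; exists (sieve W).
split; first by move=> b [].
split; first exact: sieve_irregular.
split; last exact: sieve_entropy_eq0.
apply: (@balanced_uniquely_ergodic R _ (period W)).
- exact: period_gt.
- exact: period_dvd.
- by move=> n D k t s; exact: sieve_visits.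
Qed.
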